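(* Let $0<\alpha\le\infty$. For every $n\in\mathbb{N}$ (with $n\ge1$), $S_{\mathrm{pos}}^{(2n)}(-\alpha,\alpha)\subset S_{\mathrm{mono}}^{(n)}(-\alpha,\alpha)$ and $S_{\mathrm{mono}}^{(2n)}(-\alpha,\alpha)\subset S_{\mathrm{conv}}^{(n)}(-\alpha,\alpha)$.
   Context: For a real function $f$ on $(-\alpha,\alpha)$ and a real matrix $A=[a_{ij}]$ with all entries in $(-\alpha,\alpha)$, $f[A]:=[f(a_{ij})]$. For real symmetric matrices, $A\ge0$ means positive semidefinite, and $A\ge B$ means $A-B\ge0$. The following are sets of real functions $f$ on $(-\alpha,\alpha)$: - $S_{\mathrm{pos}}^{(n)}(-\alpha,\alpha)$: those with $f[A]\ge0$ for all $A\ge0$ in $M_n(\mathbb{R})$ with entries in $(-\alpha,\alpha)$. - $S_{\mathrm{mono}}^{(n)}(-\alpha,\alpha)$: those for which $A\ge B\ge0$ implies $f[A]\ge f[B]$ for all symmetric $A,B\in M_n(\mathbb{R})$ with entries in $(-\alpha,\alpha)$. - $S_{\mathrm{conv}}^{(n)}(-\alpha,\alpha)$: those for which $A\ge B\ge0$ implies $f[\lambda A+(1-\lambda)B]\le\lambda f[A]+(1-\lambda)f[B]$ for all $0\le\lambda\le1$, for all symmetric $A,B\in M_n(\mathbb{R})$ with entries in $(-\alpha,\alpha)$. *)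

(* Defs.v *)
From mathcomp Require Import all_boot all_order all_algebra.
From mathcomp Require Import all_classical all_reals all_analysis.

Set Implicit Arguments.
Unset Strict Implicit.
Unset Printing Implicit Defensive.

Import Order.TTheory GRing.Theory Num.Theory.

Local Open Scope ring_scope.
Local Open Scope classical_set_scope.

(* The bound [alpha] lives in [\bar R], since alpha = +oo is allowed. *)
Definition entries_in (R : realType) (alpha : \bar R) (n : nat)
    (A : 'M[R]_n) : Prop :=
  forall i j : 'I_n, (- alpha < (A i j)%:E < alpha)%E.

Definition psdmx (R : realType) (n : nat) (A : 'M[R]_n) : Prop :=
  A \is symmetricmx /\ forall x : 'cV[R]_n, 0 <= (x^T *m A *m x) 0 0.

Definition gemx (R : realType) (n : nat) (A B : 'M[R]_n) : Prop :=
  psdmx (A - B).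

(* A real function on (-alpha, alpha) is represented by a total function
   [f : R -> R]; the three conditions below apply [f] only to points of
   (-alpha, alpha) (which is convex), so its values elsewhere are irrelevant.
   The matrix f[A] is [map_mx f A]. *)
Definition Spos (R : realType) (alpha : \bar R) (n : nat) : set (R -> R) :=
  [set f | forall A : 'M[R]_n, entries_in alpha A ->
    psdmx A -> psdmx (map_mx f A)].

Definition Smono (R : realType) (alpha : \bar R) (n : nat) : set (R -> R) :=
  [set f | forall A B : 'M[R]_n,
    A \is symmetricmx -> B \is symmetricmx ->
    entries_in alpha A -> entries_in alpha B ->
    gemx A B -> psdmx B -> gemx (map_mx f A) (map_mx f B)].

Definition Sconv (R : realType) (alpha : \bar R) (n : nat) : set (R -> R) :=
  [set f | forall A B : 'M[R]_n,
    A \is symmetricmx -> B \is symmetricmx ->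
    entries_in alpha A -> entries_in alpha B ->
    gemx A B -> psdmx B ->
    forall lambda : R, 0 <= lambda <= 1 ->
      gemx (lambda *: map_mx f A + (1 - lambda) *: map_mx f B)
           (map_mx f (lambda *: A + (1 - lambda) *: B))].

(* Main.v *)
Require Import Defs.
From mathcomp Require Import all_boot all_order all_algebra.
From mathcomp Require Import all_classical all_reals all_analysis.
From mathcomp Require Import ring lra.

(** Both inclusions come from evaluating the hypothesis on 2n x 2n block
matrices and reading the conclusion on vectors [(x, -x)], where a block matrix
with blocks P, Q, R, S has quadratic form that of [P - Q - R + S]
([psdmx_antidiag]).

Positivity gives monotonicity: if [A >= B >= 0], the matrix with blocks
[A, B, B, B] is the sum of [A - B] in the upper left corner and of four copies
of [B], so it is positive semidefinite ([psdmx_block_corner]). Its image under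
[f] has blocks [f[A], f[B], f[B], f[B]], and the vectors [(x, -x)] see exactly
[f[A] - f[B]].

Monotonicity gives midpoint convexity: with [M = (A + B) / 2], set
[X] = [A, M, M, M] and [Y] = [M, B, B, B] (blocks). All four blocks of [X - Y]
equal [(A - B) / 2], so [X >= Y >= 0], and the vectors [(x, -x)] turn
[f[X] >= f[Y]] into [f[A] - f[M] >= f[M] - f[B]] ([Smono_midpoint]).

It remains to pass from midpoints to all weights, for [f] possibly
discontinuous. Fix [x] and let [g(t)] be the quadratic form of [f[t A + (1 - t) B]] at
[x]. The matrices [t A + (1 - t) B] increase with [t], so [g] is midpoint convex
on [0, 1], and it is bounded above by [g(1)] because [f] is also monotone on
n x n matrices ([Smono_half]). A midpoint convex function that is bounded above
lies below its chord ([midconvex_max1_le_chord]). *)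

Local Open Scope ring_scope.
Local Open Scope classical_set_scope.

Set Implicit Arguments.
Unset Strict Implicit.
Unset Printing Implicit Defensive.

Import Order.TTheory GRing.Theory Num.Theory.

Section PositiveSemidefinite.
Context (R : realType).

Lemma symmetricmxP n (A : 'M[R]_n) : A \is symmetricmx <-> A^T = A.
Proof.
rewrite is_hermitianmxE expr0 scale1r map_mx_id //.
by split=> [/eqP|->].
Qed.

Lemma psdmxD n (A B : 'M[R]_n) : psdmx A -> psdmx B -> psdmx (A + B).
Proof.
move=> [/symmetricmxP sA pA] [/symmetricmxP sB pB]; split.
  by apply/symmetricmxP; rewrite linearD /= sA sB.
by move=> x; rewrite mulmxDr mulmxDl mxE addr_ge0.
Qed.

Lemma psdmxZ n (c : R) (A : 'M[R]_n) : 0 <= c -> psdmx A -> psdmx (c *: A).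
Proof.
move=> c0 [/symmetricmxP sA pA]; split.
  by apply/symmetricmxP; rewrite linearZ /= sA.
by move=> x; rewrite -scalemxAr -scalemxAl mxE mulr_ge0.
Qed.

Lemma psdmx_congr m n (C : 'M[R]_(n, m)) (A : 'M[R]_n) :
  psdmx A -> psdmx (C^T *m A *m C).
Proof.
move=> [/symmetricmxP sA pA]; split.
  by apply/symmetricmxP; rewrite !trmx_mul trmxK sA mulmxA.
by move=> x; have := pA (C *m x); rewrite trmx_mul !mulmxA.
Qed.

(** The quadratic form at [(x, y)] is that of [A] at [x + y]. *)
Lemma psdmx_block_const n (A : 'M[R]_n) : psdmx A -> psdmx (block_mx A A A A).
Proof.
move=> /(psdmx_congr (row_mx 1%:M (1%:M : 'M[R]_n))).
by rewrite tr_row_mx trmx1 mul_col_mx mul_col_row !mul1mx !mulmx1.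
Qed.

Lemma psdmx_block_ul n (A : 'M[R]_n) :
  psdmx A -> psdmx (block_mx A 0 0 (0 : 'M[R]_n)).
Proof.
move=> /(psdmx_congr (row_mx 1%:M (0 : 'M[R]_n))).
by rewrite tr_row_mx trmx1 trmx0 mul_col_mx mul_col_row
  !(mul1mx, mul0mx, mulmx1, mulmx0).
Qed.

Lemma psdmx_ulsubmx n (A B C D : 'M[R]_n) :
  psdmx (block_mx A B C D) -> psdmx A.
Proof.
move=> /(psdmx_congr (col_mx 1%:M (0 : 'M[R]_n))).
by rewrite tr_col_mx trmx1 trmx0 mul_row_block mul_row_col
  !(mul1mx, mul0mx, mulmx1, mulmx0, addr0).
Qed.

(** Congruence by the column of blocks [1, -1], that is, restriction of the
quadratic form to the vectors [(x, -x)]. *)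
Lemma psdmx_antidiag n (A B C D : 'M[R]_n) :
  psdmx (block_mx A B C D) -> psdmx (A - B - C + D).
Proof.
move=> /(psdmx_congr (col_mx 1%:M (- 1%:M : 'M[R]_n))).
rewrite tr_col_mx linearN /= trmx1 mul_row_block mul_row_col.
rewrite !(mul1mx, mulNmx, mulmxN, mulmx1) opprB.
by congr psdmx; apply/matrixP => i j; rewrite !mxE; ring.
Qed.

Lemma block_mxB m1 m2 n1 n2 (A A' : 'M[R]_(m1, n1)) (B B' : 'M[R]_(m1, n2))
    (C C' : 'M[R]_(m2, n1)) (D D' : 'M[R]_(m2, n2)) :
  block_mx A B C D - block_mx A' B' C' D' =
  block_mx (A - A') (B - B') (C - C') (D - D').
Proof. by rewrite opp_block_mx add_block_mx. Qed.

(** The quadratic form at [(x, y)] is that of [A - B] at [x] plus that of [B]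
at [x + y]. *)
Lemma psdmx_block_corner n (A B : 'M[R]_n) :
  gemx A B -> psdmx B -> psdmx (block_mx A B B B).
Proof.
move=> AB B0.
have := psdmxD (psdmx_block_ul AB) (psdmx_block_const B0).
by rewrite add_block_mx !add0r subrK.
Qed.

End PositiveSemidefinite.

Section Entries.
Context (R : realType) (alpha : \bar R).

Lemma entries_in_block n (A B C D : 'M[R]_n) :
  entries_in alpha A -> entries_in alpha B ->
  entries_in alpha C -> entries_in alpha D ->
  entries_in alpha (block_mx A B C D).
Proof.
move=> eA eB eC eD i j; rewrite /block_mx mxE.
by case: (fintype.split i) => k; rewrite mxE; case: (fintype.split j) => l.
Qed.

Lemma entries_in_convex n (A B : 'M[R]_n) (t : R) : 0 <= t <= 1 ->
  entries_in alpha A -> entries_in alpha B ->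
  entries_in alpha (t *: A + (1 - t) *: B).
Proof.
move=> /andP[t0 t1] eA eB i j; rewrite !mxE.
move: (A i j) (B i j) (eA i j) (eB i j) => a b.
case: alpha => [r| |] //=; last by rewrite !ltNyr !ltry.
rewrite !lte_fin => /andP[a1 a2] /andP[b1 b2].
(* The bounds are strict because one of the two weights is positive. *)
have [->|t_neq0] := eqVneq t 0; first by apply/andP; split; lra.
have {t_neq0} t_gt0 : 0 < t by rewrite lt_def t_neq0.
by apply/andP; split; nra.
Qed.

End Entries.

Section MidpointConvexity.
Context (R : realType).

(** Every [t] is the midpoint of some [s] in [0, 1] and one of the endpoints
0 and 1, where [h <= 0]; so [2 h(t) <= h(s)]. Iterating [k] times gives
[2^k h(t) <= C], which for all [k] forces [h(t) <= 0]. *)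
Lemma bounded_midconvex_le0 (h : R -> R) (C : R) :
  h 0 <= 0 -> h 1 <= 0 ->
  (forall t, 0 <= t <= 1 -> h t <= C) ->
  (forall s t, 0 <= s -> s <= t -> t <= 1 ->
     2 * h ((s + t) / 2) <= h s + h t) ->
  forall t, 0 <= t <= 1 -> h t <= 0.
Proof.
move=> h0 h1 hC hmid.
have halving k t : 0 <= t <= 1 -> 2 ^+ k * h t <= C.
  elim: k t => [|k IH] t t01; first by rewrite expr0 mul1r hC.
  have /andP[t0 t1] := t01.
  have p0 : 0 < 2 ^+ k :> R by rewrite exprn_gt0.
  rewrite exprS; have [t2|t2] := leP t 2^-1.
  - have /IH : 0 <= 2 * t <= 1 by apply/andP; split; lra.
    have := hmid 0 (2 * t) (lexx 0) ltac:(lra) ltac:(lra).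
    rewrite (_ : (0 + 2 * t) / 2 = t); last by field.
    nra.
  - have /IH : 0 <= 2 * t - 1 <= 1 by apply/andP; split; lra.
    have := hmid (2 * t - 1) 1 ltac:(lra) ltac:(lra) (lexx 1).
    rewrite (_ : (2 * t - 1 + 1) / 2 = t); last by field.
    nra.
move=> t t01; rewrite leNgt; apply/negP => ht.
(* If [h t] were positive, [2^N] would exceed [C / h t] for large [N]. *)
set N := Num.bound (C / h t).
have C0 : 0 <= C / h t by rewrite divr_ge0 ?(ltW ht) // (le_trans _ (hC t t01)) ?ltW.
have : C < N%:R * h t by rewrite -ltr_pdivrMr // archi_boundP.
rewrite ltNge => /negP; apply.
apply: le_trans (halving N t t01); rewrite ler_pM2r //.
by rewrite -natrX ler_nat ltnW // ltn_expl.
Qed.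

(** Subtracting the chord keeps midpoint convexity and makes both endpoint
values zero; the difference is bounded above since [g] is and the chord is
bounded below by [g 0]. *)
Lemma midconvex_max1_le_chord (g : R -> R) :
  (forall t, 0 <= t <= 1 -> g t <= g 1) ->
  (forall s t, 0 <= s -> s <= t -> t <= 1 ->
     2 * g ((s + t) / 2) <= g s + g t) ->
  forall t, 0 <= t <= 1 -> g t <= t * g 1 + (1 - t) * g 0.
Proof.
move=> gmax gmid t t01.
have g01 : g 0 <= g 1 by apply: gmax; rewrite lexx ler01.
pose h s := g s - (s * g 1 + (1 - s) * g 0).
suff : h t <= 0 by rewrite subr_le0.
apply: (bounded_midconvex_le0 (h := h) (C := g 1 - g 0)) t01; rewrite /h.
- by rewrite mul0r subr0 mul1r add0r subrr.
- by rewrite subrr mul0r mul1r addr0 subrr.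
- by move=> s s01; have := gmax s s01; move/andP: s01 => [s0 s1]; nra.
- move=> r s r0 rs s1; have := gmid r s r0 rs s1; lra.
Qed.

End MidpointConvexity.

Section Inclusions.
Context (R : realType) (alpha : \bar R) (n : nat).

Lemma Spos_Smono (f : R -> R) : Spos alpha (n + n) f -> Smono alpha n f.
Proof.
move=> fpos A B _ _ eA eB AB B0.
have eX := entries_in_block eA eB eB eB.
have := fpos _ eX (psdmx_block_corner AB B0).
by rewrite map_block_mx => /psdmx_antidiag; rewrite subrK.
Qed.

(** Repeating a matrix in all four blocks preserves both the order and the
range of the entries. *)
Lemma Smono_half (f : R -> R) : Smono alpha (n + n) f -> Smono alpha n f.
Proof.
move=> fmono A B _ _ eA eB AB B0.
have XY : gemx (block_mx A A A A) (block_mx B B B B).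
  by rewrite /gemx block_mxB; exact: psdmx_block_const.
have Y_psd := psdmx_block_const B0.
have X_psd := psdmxD XY Y_psd; rewrite subrK in X_psd.
have := fmono _ _ X_psd.1 Y_psd.1 (entries_in_block eA eA eA eA)
  (entries_in_block eB eB eB eB) XY Y_psd.
by rewrite !map_block_mx /gemx block_mxB => /psdmx_ulsubmx.
Qed.

(** The blocks are chosen so that on [(x, -x)] all terms of [f[X]] and [f[Y]]
other than [f[A]], [f[B]] and [f[M]] cancel, while [X - Y] has four equal
blocks. *)
Lemma Smono_midpoint (f : R -> R) (A B : 'M[R]_n) :
  Smono alpha (n + n) f ->
  entries_in alpha A -> entries_in alpha B -> gemx A B -> psdmx B ->
  gemx (map_mx f A + map_mx f B) (2 *: map_mx f (2^-1 *: (A + B))).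
Proof.
move=> fmono eA eB AB B0; set M := 2^-1 *: (A + B).
have AM : A - M = 2^-1 *: (A - B).
  by apply/matrixP => i j; rewrite !mxE; field.
have MB : M - B = 2^-1 *: (A - B).
  by apply/matrixP => i j; rewrite !mxE; field.
have eM : entries_in alpha M.
  rewrite /M scalerDr (_ : 2^-1 *: B = (1 - 2^-1) *: B); last first.
    by congr (_ *: _); field.
  by apply: entries_in_convex => //; apply/andP; split; lra.
have half_psd : psdmx (2^-1 *: (A - B)) by apply: psdmxZ; rewrite ?invr_ge0.
have MgeB : gemx M B by rewrite /gemx MB.
have Y_psd := psdmx_block_corner MgeB B0.
have XY : gemx (block_mx A M M M) (block_mx M B B B).
  by rewrite /gemx block_mxB AM MB; exact: psdmx_block_const half_psd.
have X_psd := psdmxD XY Y_psd; rewrite subrK in X_psd.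
have := fmono _ _ X_psd.1 Y_psd.1 (entries_in_block eA eM eM eM)
  (entries_in_block eM eB eB eB) XY Y_psd.
rewrite !map_block_mx /gemx block_mxB => /psdmx_antidiag.
by congr psdmx; apply/matrixP => i j; rewrite !mxE; ring.
Qed.

Lemma Smono_Sconv (f : R -> R) : Smono alpha (n + n) f -> Sconv alpha n f.
Proof.
move=> f2mono A B /symmetricmxP sA /symmetricmxP sB eA eB AB B0 l l01.
have fmono := Smono_half f2mono.
pose seg t : 'M[R]_n := t *: A + (1 - t) *: B.
have seg_sym t : (seg t)^T = seg t by rewrite linearD !linearZ /= sA sB.
have seg_sub s t : seg t - seg s = (t - s) *: (A - B).
  by apply/matrixP => i j; rewrite !mxE; ring.
have seg0 : seg 0 = B by rewrite /seg scale0r subr0 scale1r add0r.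
have seg1 : seg 1 = A by rewrite /seg scale1r subrr scale0r addr0.
have seg_mono s t : s <= t -> gemx (seg t) (seg s).
  by move=> st; rewrite /gemx seg_sub; apply: psdmxZ; rewrite ?subr_ge0.
have seg_psd t : 0 <= t -> psdmx (seg t).
  by move=> t0; have := psdmxD (seg_mono _ _ t0) B0; rewrite -seg0 subrK.
have seg_in t : 0 <= t <= 1 -> entries_in alpha (seg t).
  by move=> t01; exact: entries_in_convex.
split=> [|x].
  apply/symmetricmxP.
  by rewrite linearB linearD !linearZ /= !map_trmx sA sB seg_sym.
pose q (M : 'M[R]_n) : R := (x^T *m M *m x) 0 0.
have qD M N : q (M + N) = q M + q N by rewrite /q mulmxDr mulmxDl mxE.
have qN M : q (- M) = - q M by rewrite /q mulmxN mulNmx mxE.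
have qZ c M : q (c *: M) = c * q M by rewrite /q -scalemxAr -scalemxAl mxE.
pose g t := q (map_mx f (seg t)).
suff : g l <= l * g 1 + (1 - l) * g 0.
  rewrite /g seg1 seg0 -!qZ -qD -subr_ge0 -qN -qD; exact.
apply: midconvex_max1_le_chord l01.
- move=> t t01; have /andP[t0 t1] := t01.
  have one01 : 0 <= (1 : R) <= 1 by rewrite ler01 lexx.
  have [_ /(_ x)] := fmono _ _ (seg_psd _ ler01).1 (seg_psd _ t0).1
    (seg_in 1 one01) (seg_in _ t01)
    (seg_mono _ _ t1) (seg_psd _ t0).
  by rewrite -[X in 0 <= X]/(q _) qD qN subr_ge0.
- move=> s t s0 st t1.
  have s01 : 0 <= s <= 1 by rewrite s0 (le_trans st).
  have t01 : 0 <= t <= 1 by rewrite t1 (le_trans s0).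
  have [_ /(_ x)] := Smono_midpoint f2mono (seg_in _ t01) (seg_in _ s01)
    (seg_mono _ _ st) (seg_psd _ s0).
  rewrite -[X in 0 <= X]/(q _) qD qN subr_ge0 qD qZ [q _ + q _]addrC.
  rewrite (_ : 2^-1 *: (seg t + seg s) = seg ((s + t) / 2)) //.
  by apply/matrixP => i j; rewrite !mxE; field.
Qed.

End Inclusions.

Theorem proposition3p1 (R : realType) (alpha : \bar R)
    (halpha : (0 < alpha)%E) (n : nat) (hn : (0 < n)%N) :
  Spos alpha (2 * n)%N `<=` Smono alpha n /\
  Smono alpha (2 * n)%N `<=` Sconv alpha n.
Proof.
rewrite mul2n -addnn; split=> f; [exact: Spos_Smono | exact: Smono_Sconv].
Qed.
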